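(* Let $\lambda$ be a regular cardinal, let $\mathscr U=\{u\subseteq\lambda:\mathrm{cf}(\sup(u))\ne\mathrm{cf}(|u|)\}$, and let $\mathscr D$ be a fine normal filter on $\mathscr U$. Then there are functions $f^*_i$ for $i<\lambda^+$ with $\mathrm{Dom}(f^*_i)=\mathscr U$ and $f^*_i(u)\in u$ for all $u\in\mathscr U$, such that for all $i\ne j<\lambda^+$ the set $\{u\in\mathscr U:f^*_i(u)\ne f^*_j(u)\}$ belongs to $\mathscr D$.
   Context: A filter $\mathscr D$ on $\mathscr U\subseteq\mathcal P(\lambda)$ is fine if $\{u\in\mathscr U:\alpha\in u\}\in\mathscr D$ for every $\alpha<\lambda$, and normal if for every sequence $\langle X_\alpha:\alpha<\lambda\rangle$ of members of $\mathscr D$ the diagonal intersection $\{u\in\mathscr U:u\in X_\alpha\text{ for all }\alpha\in u\}$ belongs to $\mathscr D$. *)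

(* Defs.v *)
(* Ordinals/cardinals below lambda^+ are modelled by
   well-ordered types: lambda is a type L with a well-order ltL that is an
   initial ordinal (cardinal); ordinals <= lambda are down-closed subsets
   of L; sets are predicates. *)
From Stdlib Require Import Classical.

Set Implicit Arguments.

Definition set (T : Type) := T -> Prop.

Definition injects {A B : Type} (P : set A) (Q : set B) : Prop :=
  exists f : {a | P a} -> {b | Q b}, forall x y, f x = f y -> x = y.

Definition equipotent {A B : Type} (P : set A) (Q : set B) : Prop :=
  exists f : {a | P a} -> {b | Q b},
    (forall x y, f x = f y -> x = y) /\ (forall y, exists x, f x = y).

Definition full (T : Type) : set T := fun _ => True.
Arguments full T _ : clear implicits.

Record well_order {T : Type} (lt : T -> T -> Prop) : Prop := {
  wo_trans : forall x y z, lt x y -> lt y z -> lt x z;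
  wo_irrefl : forall x, ~ lt x x;
  wo_total : forall x y, lt x y \/ x = y \/ lt y x;
  wo_wf : well_founded lt }.

Definition le {T : Type} (lt : T -> T -> Prop) (x y : T) := lt x y \/ x = y.

Definition is_cardinal {T : Type} (lt : T -> T -> Prop) : Prop :=
  well_order lt /\ forall x, ~ injects (full T) (fun y => lt y x).

Definition cofinal_in {T : Type} (lt : T -> T -> Prop) (S X : set T) : Prop :=
  (forall x, X x -> S x) /\ (forall g, S g -> exists x, X x /\ le lt g x).

Definition regular_cardinal {T : Type} (lt : T -> T -> Prop) : Prop :=
  is_cardinal lt /\ (exists f : nat -> T, forall m n, f m = f n -> m = n) /\
  (forall X, cofinal_in lt (full T) X -> injects (full T) X).

Definition downclosed {T : Type} (lt : T -> T -> Prop) (S : set T) : Prop :=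
  forall x y, S x -> lt y x -> S y.

Definition is_cf {T : Type} (lt : T -> T -> Prop) (S X : set T) : Prop :=
  cofinal_in lt S X /\ forall Y, cofinal_in lt S Y -> injects X Y.

(* the ordinal sup(u) = union of u, as a down-closed subset of T *)
Definition sup_set {T : Type} (lt : T -> T -> Prop) (u : set T) : set T :=
  fun g => exists x, u x /\ lt g x.

Definition card_ord {T : Type} (lt : T -> T -> Prop) (u S : set T) : Prop :=
  downclosed lt S /\ equipotent S u /\
  (forall g, S g -> ~ equipotent (fun d => lt d g) u).

Definition cf_neq {T : Type} (lt : T -> T -> Prop) (S1 S2 : set T) : Prop :=
  forall X Y, is_cf lt S1 X -> is_cf lt S2 Y -> ~ equipotent X Y.

Definition Ufam {T : Type} (lt : T -> T -> Prop) : set (set T) :=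
  fun u => forall S, card_ord lt u S -> cf_neq lt (sup_set lt u) S.

Definition filter_on {T : Type} (Uset : set (set T)) (D : set (set (set T))) : Prop :=
  D Uset /\ ~ D (fun _ => False) /\
  (forall X, D X -> forall u, X u -> Uset u) /\
  (forall X Y, D X -> (forall u, X u -> Y u) -> (forall u, Y u -> Uset u) -> D Y) /\
  (forall X Y, D X -> D Y -> D (fun u => X u /\ Y u)).

Definition fine {T : Type} (Uset : set (set T)) (D : set (set (set T))) : Prop :=
  forall a : T, D (fun u => Uset u /\ u a).

Definition normal {T : Type} (Uset : set (set T)) (D : set (set (set T))) : Prop :=
  forall Xs : T -> set (set T), (forall a, D (Xs a)) ->
    D (fun u => Uset u /\ forall a, u a -> Xs a u).

Definition succ_card {L K : Type} (ltL : L -> L -> Prop) (ltK : K -> K -> Prop) : Prop :=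
  well_order ltK /\ ~ injects (full K) (full L) /\
  (forall k, injects (fun k' => ltK k' k) (full L)).

(* Main.v *)
(* Since lambda is regular there are h_i : lambda -> lambda for i < lambda^+ and, for
   each j < lambda^+, ordinals F j i such that the ranges of h_i restricted to
   (F j i, lambda), i < j, are pairwise disjoint.  By normality almost every u is closed
   under a pairing function p of lambda and, for given i < j, closed under h_i and h_j
   and contains F j i.  Enumerate such a u in order type |u|.  As cf(sup u) <> cf|u|,
   for each i some proper initial segment of the enumeration, of size < |u|, contains
   h_i(a) for cofinally many a in u; let x_i in u code it.  For fixed j, the i < j with
   x_i = x_j and F j i in u pick distinct elements of that segment, so there are fewer
   than |u| of them, and one can choose y_j in u by induction on j, different from y_i
   for all these i.  Then f_i(u) = p(x_i, y_i) works. *)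
Require Import Defs.
From Stdlib Require Import Classical ClassicalEpsilon FunctionalExtensionality
  ProofIrrelevance Wellfounded Relation_Operators.

Set Implicit Arguments.

(** * Choice and injections between sets *)

Lemma choice {A B : Type} (R : A -> B -> Prop) :
  (forall a, exists b, R a b) -> exists f : A -> B, forall a, R a (f a).
Proof.
  intros H.
  exists (fun a => proj1_sig (constructive_indefinite_description _ (H a))).
  intros a. exact (proj2_sig (constructive_indefinite_description _ (H a))).
Qed.

Lemma sig_eq {A : Type} {P : set A} (x y : {a | P a}) :
  proj1_sig x = proj1_sig y -> x = y.
Proof.
  destruct x as [x Hx], y as [y Hy]; simpl; intros <-.
  f_equal; apply proof_irrelevance.
Qed.

(** [R] may be multivalued: choice picks one value, and the second condition keeps distinct points
    apart. *)
Lemma injects_rel {A B : Type} (P : set A) (Q : set B) (R : A -> B -> Prop) :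
  (forall a, P a -> exists b, Q b /\ R a b) ->
  (forall a a' b, P a -> P a' -> R a b -> R a' b -> a = a') ->
  injects P Q.
Proof.
  intros Htot Hinj.
  destruct (choice (fun (a : {a | P a}) (b : {b | Q b}) =>
    R (proj1_sig a) (proj1_sig b))) as [f Hf].
  { intros [a Ha]. destruct (Htot a Ha) as [b [Hb Hab]].
    exists (exist _ b Hb). exact Hab. }
  exists f. intros x y Hxy. apply sig_eq.
  apply (Hinj _ _ (proj1_sig (f x)) (proj2_sig x) (proj2_sig y)).
  - apply Hf.
  - rewrite Hxy. apply Hf.
Qed.

Lemma injects_map {A B : Type} (P : set A) (Q : set B) (f : A -> B) :
  (forall a, P a -> Q (f a)) ->
  (forall a a', P a -> P a' -> f a = f a' -> a = a') -> injects P Q.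
Proof.
  intros HQ Hinj. apply injects_rel with (R := fun a b => f a = b).
  - intros a Ha. exists (f a). auto.
  - intros a a' b Ha Ha' H H'. apply Hinj; congruence.
Qed.

Lemma injects_fun {A B : Type} (b0 : B) (P : set A) (Q : set B) :
  injects P Q -> exists f : A -> B, (forall a, P a -> Q (f a)) /\
    (forall a a', P a -> P a' -> f a = f a' -> a = a').
Proof.
  intros [f Hf].
  destruct (choice (fun a b => forall H : P a, b = proj1_sig (f (exist _ a H))))
    as [g Hg].
  { intros a. destruct (classic (P a)) as [Ha | Ha].
    - exists (proj1_sig (f (exist _ a Ha))). intros H.
      now rewrite (proof_irrelevance _ H Ha).
    - exists b0. contradiction. }
  exists g. split.
  - intros a Ha. rewrite (Hg a Ha). apply proj2_sig.
  - intros a a' Ha Ha' E. rewrite (Hg a Ha), (Hg a' Ha') in E.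
    apply sig_eq, Hf in E. now inversion E.
Qed.

Lemma injects_trans {A B C : Type} (P : set A) (Q : set B) (S : set C) :
  injects P Q -> injects Q S -> injects P S.
Proof.
  intros [f Hf] [g Hg]. exists (fun x => g (f x)). auto.
Qed.

Lemma injects_sub {A : Type} (P Q : set A) :
  (forall a, P a -> Q a) -> injects P Q.
Proof. intros H. apply injects_map with (f := fun a => a); auto. Qed.

Lemma injects_image {A B : Type} (P : set A) (f : A -> B) :
  injects (fun b => exists a, P a /\ f a = b) P.
Proof.
  apply injects_rel with (R := fun b a => f a = b).
  - intros b [a [Ha E]]. eauto.
  - congruence.
Qed.

(** * The Cantor-Bernstein theorem *)

Section CantorBernstein.
Variables (A B : Type) (f : A -> B) (g : B -> A).

(** The points whose chain of preimages stops in [A], outside the range of [g]. The bijection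
    follows [f] on them and the inverse of [g] elsewhere. *)
Inductive cb_orbit : A -> Prop :=
| cb_start a : (forall b, g b <> a) -> cb_orbit a
| cb_step a : cb_orbit a -> cb_orbit (g (f a)).

Lemma cantor_bernstein :
  (forall x y, f x = f y -> x = y) -> (forall x y, g x = g y -> x = y) ->
  exists h : A -> B, (forall x y, h x = h y -> x = y) /\ (forall y, exists x, h x = y).
Proof.
  intros Hf Hg.
  destruct (choice (fun a b => (cb_orbit a /\ b = f a) \/ (~ cb_orbit a /\ g b = a)))
    as [h Hh].
  { intros a. destruct (classic (cb_orbit a)) as [Ha | Ha]; [eauto |].
    destruct (classic (exists b, g b = a)) as [[b Hb] | Hb]; [eauto |].
    destruct Ha. apply cb_start. eauto. }
  exists h. split.
  - intros x y E.
    destruct (Hh x) as [[Hx Ex] | [Hx Ex]], (Hh y) as [[Hy Ey] | [Hy Ey]].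
    + apply Hf. congruence.
    + destruct Hy. rewrite <- Ey, <- E, Ex. now apply cb_step.
    + destruct Hx. rewrite <- Ex, E, Ey. now apply cb_step.
    + congruence.
  - intros b. destruct (Hh (g b)) as [[Hb E] | [Hb E]].
    + inversion Hb as [a Ha | a Ha Ea].
      * now destruct (Ha b).
      * exists a. apply Hg in Ea.
        destruct (Hh a) as [[_ E'] | [Hn _]]; [congruence | contradiction].
    + exists (g b). now apply Hg.
Qed.
End CantorBernstein.

Lemma injects_antisym {A B : Type} (P : set A) (Q : set B) :
  injects P Q -> injects Q P -> equipotent P Q.
Proof.
  intros [f Hf] [g Hg]. exact (cantor_bernstein f g Hf Hg).
Qed.

(** * Least elements and greedy recursion *)

Lemma wf_least {T : Type} (lt : T -> T -> Prop) (P : set T) :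
  well_founded lt -> (exists x, P x) ->
  exists x, P x /\ forall y, lt y x -> ~ P y.
Proof.
  intros Hwf [x Hx]. apply NNPP. intros Hn. revert Hx.
  induction x as [x IH] using (well_founded_ind Hwf). intros Hx.
  apply Hn. exists x. eauto.
Qed.

(* The last clause, minimality of the choice, is what makes the collapsing maps
   below have down-closed range. *)
Lemma greedy {T I : Type} (lt : T -> T -> Prop) (R : I -> I -> Prop) (U : set T) :
  well_founded lt -> well_founded R ->
  (forall j, ~ injects U (fun i => R i j)) ->
  exists y : I -> T, forall j, U (y j) /\ (forall i, R i j -> y i <> y j) /\
    (forall x, U x -> lt x (y j) -> exists i, R i j /\ y i = x).
Proof.
  intros Hlt HR Hsmall.
  assert (Hstep : forall j (prev : forall i, R i j -> T), exists x,
    (U x /\ forall i H, prev i H <> x) /\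
    forall x', lt x' x -> ~ (U x' /\ forall i H, prev i H <> x')).
  (* If every point of [U] were taken, sending each to an index that took it would inject [U] into
     the predecessors of [j]. *)
  { intros j prev. apply wf_least; [exact Hlt |]. apply NNPP. intros Hn.
    apply (Hsmall j).
    apply injects_rel with (R := fun x i => exists H, prev i H = x).
    - intros x Hx. apply NNPP. intros Hx'. apply Hn. exists x.
      split; [exact Hx |]. intros i H E. apply Hx'. exists i. eauto.
    - intros a a' i _ _ [H E] [H' E'].
      rewrite (proof_irrelevance _ H' H) in E'. congruence. }
  pose (step := fun j prev => constructive_indefinite_description _ (Hstep j prev)).
  pose (y := Fix HR (fun _ => T) (fun j prev => proj1_sig (step j prev))).
  assert (Hy : forall j, y j = proj1_sig (step j (fun i _ => y i))).
  { intros j. unfold y at 1. rewrite Fix_eq; [reflexivity |].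
    intros j' f g E. assert (Efg : f = g).
    { apply functional_extensionality_dep; intros i.
      apply functional_extensionality_dep; intros H. apply E. }
    now rewrite Efg. }
  exists y. intros j. rewrite (Hy j).
  destruct (step j (fun i _ => y i)) as [x [[HU Hx] Hmin]]; simpl.
  split; [exact HU |]. split; [exact Hx |].
  intros x' HU' Hlt'. apply NNPP. intros Hn. apply (Hmin x' Hlt').
  split; [exact HU' |]. intros i H E. apply Hn. eauto.
Qed.

(** * Initial segments and sizes of subsets of a cardinal *)

Lemma le_or_lt {T : Type} (lt : T -> T -> Prop) (Hwo : well_order lt) x y :
  le lt x y \/ lt y x.
Proof. unfold le. destruct (wo_total Hwo x y) as [H | [H | H]]; auto. Qed.

Lemma le_lt_trans {T : Type} (lt : T -> T -> Prop) (Hwo : well_order lt) {x y z} :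
  le lt x y -> lt y z -> lt x z.
Proof. intros [H | ->] H'; [eapply wo_trans; eauto | exact H']. Qed.

Lemma lt_le_trans {T : Type} (lt : T -> T -> Prop) (Hwo : well_order lt) {x y z} :
  lt x y -> le lt y z -> lt x z.
Proof. intros H [H' | <-]; [eapply wo_trans; eauto | exact H]. Qed.

Section Cardinal.
Variables (L : Type) (lt : L -> L -> Prop).
Hypothesis Hcard : is_cardinal lt.
Let Hwo : well_order lt := proj1 Hcard.

Lemma collapse (A : Type) (phi : A -> L) :
  (forall a b, phi a = phi b -> a = b) ->
  exists c : A -> L, (forall a b, c a = c b -> a = b) /\
    downclosed lt (fun s => exists a, c a = s) /\ (forall a, le lt (c a) (phi a)).
Proof.
  intros Hphi.
  assert (Hwf : well_founded (fun a b => lt (phi a) (phi b))).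
  { apply (wf_inverse_image A L lt phi), (wo_wf Hwo). }
  destruct (greedy (U := full L) (wo_wf Hwo) Hwf) as [c Hc].
  { intros a H. apply (proj2 Hcard (phi a)).
    apply (injects_trans H). apply injects_map with (f := phi); auto. }
  exists c. repeat split.
  - intros a b E. destruct (wo_total Hwo (phi a) (phi b)) as [H | [H | H]].
    + now apply Hc in H.
    + auto.
    + apply Hc in H. congruence.
  - intros x y [a <-] Hy. destruct (Hc a) as [_ [_ H]].
    destruct (H y I Hy) as [b [_ Hb]]. eauto.
  - intros a. induction a as [a IH] using (well_founded_ind Hwf).
    destruct (le_or_lt Hwo (c a) (phi a)) as [H | H]; [exact H | exfalso].
    destruct (Hc a) as [_ [_ H']]. destruct (H' _ I H) as [b [Hb E]].
    specialize (IH b Hb). rewrite E in IH.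
    exact (wo_irrefl Hwo _ (le_lt_trans Hwo IH Hb)).
Qed.

(** Collapse [Z] to an initial segment: either it covers [T], or it misses some [d] in [T] and so
    lies below [d]. *)
Lemma injects_or_bounded (T Z : set L) :
  injects T Z \/ exists d, T d /\ injects Z (fun x => lt x d).
Proof.
  destruct (@collapse {a | Z a} (@proj1_sig _ _)) as [c [Hinj [Hdown _]]].
  { apply sig_eq. }
  destruct (classic (exists d, T d /\ ~ exists a, c a = d)) as [[d [Hd Hn]] | Hn].
  - right. exists d. split; [exact Hd |].
    apply injects_rel with (R := fun z x => exists H : Z z, c (exist _ z H) = x).
    + intros z Hz. exists (c (exist _ z Hz)). split; [| eauto].
      destruct (le_or_lt Hwo d (c (exist _ z Hz))) as [H | H]; [| exact H].
      destruct Hn. destruct H as [H | ->]; [| eauto].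
      apply Hdown with (c (exist _ z Hz)); eauto.
    + intros a a' b _ _ [H E] [H' E']. rewrite <- E' in E.
      apply Hinj in E. now inversion E.
  - left. apply injects_rel with (R := fun t z => exists H : Z z, c (exist _ z H) = t).
    + intros t Ht. apply NNPP. intros Hn'. apply Hn. exists t. split; [exact Ht |].
      intros [[z Hz] E]. apply Hn'. exists z. eauto.
    + intros a a' b _ _ [H E] [H' E'].
      rewrite (proof_irrelevance _ H' H) in E'. congruence.
Qed.

(** Supplies cofinal sets of least size. For the least [g] below which some member injects, a member
    too small to receive that segment would inject below a smaller [d]. *)
Lemma least_cardinality (P : set (set L)) :
  (exists W, P W) -> exists Y, P Y /\ forall Z, P Z -> injects Y Z.
Proof.
  intros [W HW].
  destruct (classic (exists g Y, P Y /\ injects Y (fun d => lt d g))) as [H | H].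
  - destruct (wf_least _ (wo_wf Hwo) H) as [g [[Y [HY Hg]] Hmin]].
    exists Y. split; [exact HY |]. intros Z HZ.
    destruct (injects_or_bounded (fun d => lt d g) Z) as [H' | [d [Hd H']]].
    + exact (injects_trans Hg H').
    + destruct (Hmin d Hd). eauto.
  - exists W. split; [exact HW |]. intros Z HZ.
    destruct (injects_or_bounded W Z) as [H' | [d [_ H']]]; [exact H' |].
    destruct H. eauto.
Qed.

(** [S] is the ordinal |u| and [c] a bijection of [u] onto it. *)
Lemma card_enumeration (u : set L) :
  exists (S : set L) (c : L -> L), downclosed lt S /\
    (forall a, u a -> S (c a)) /\
    (forall a b, u a -> u b -> c a = c b -> a = b) /\
    (forall s, S s -> exists a, u a /\ c a = s) /\
    (forall s, S s -> ~ injects u (fun d => lt d s)).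
Proof.
  assert (H : exists phi : {a | u a} -> L, (forall a b, phi a = phi b -> a = b) /\
    forall a g, le lt g (phi a) -> ~ injects u (fun d => lt d g)).
  (* Inject [u] below the least possible [g], or use the identity if there is no such [g].
     Collapsing does not raise values, so minimality of [g] still applies to them. *)
  { destruct (classic (exists g, injects u (fun d => lt d g))) as [H | H].
    - destruct (wf_least _ (wo_wf Hwo) H) as [g [[f Hf] Hmin]].
      exists (fun a => proj1_sig (f a)). split.
      + intros a b E. now apply Hf, sig_eq.
      + intros a g' Hg'. apply Hmin.
        exact (le_lt_trans Hwo Hg' (proj2_sig (f a))).
    - exists (@proj1_sig _ _). split; [intros a b; apply sig_eq |]. eauto. }
  destruct H as [phi [Hphi Hsmall]].
  destruct (collapse phi Hphi) as [c [Hinj [Hdown Hle]]].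
  destruct (choice (fun a b => forall H : u a, c (exist _ a H) = b)) as [c' Hc'].
  { intros a. destruct (classic (u a)) as [Ha | Ha].
    - exists (c (exist _ a Ha)). intros H. now rewrite (proof_irrelevance _ H Ha).
    - exists a. contradiction. }
  exists (fun s => exists a, c a = s), c'. split; [exact Hdown |].
  split; [| split; [| split]].
  - intros a Ha. exists (exist _ a Ha). apply Hc'.
  - intros a b Ha Hb E. rewrite <- (Hc' a Ha), <- (Hc' b Hb) in E.
    apply Hinj in E. now inversion E.
  - intros s [[a Ha] E]. exists a. split; [exact Ha |]. now rewrite <- (Hc' a Ha).
  - intros s [a <-]. exact (Hsmall a (c a) (Hle a)).
Qed.

(** * Cofinalities of sup u and of |u| *)

Definition no_max (u : set L) : Prop := forall a, u a -> exists b, u b /\ lt a b.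

(* Otherwise [q] tends to the supremum of [S] along [u]; then [q] carries cofinal
   subsets of [sup u] to cofinal subsets of [S], while a modulus of convergence
   goes the other way, and the two cofinalities agree. *)
Lemma bounded_on_cofinal (u S : set L) (q : L -> L) :
  no_max u -> no_max S -> (forall a, u a -> S (q a)) ->
  cf_neq lt (sup_set lt u) S ->
  exists s, S s /\ forall g, u g -> exists a, u a /\ lt g a /\ lt (q a) s.
Proof.
  intros Hu HS Hq Hcf. apply NNPP. intros Hn.
  destruct (choice (fun s g => S s -> u g /\
    forall a, u a -> lt g a -> le lt s (q a))) as [beta Hbeta].
  { intros s. destruct (classic (S s)) as [Hs | Hs]; [| exists s; contradiction].
    apply NNPP. intros Hg. apply Hn. exists s. split; [exact Hs |].
    intros g Hug. apply NNPP. intros Ha. apply Hg. exists g. intros _.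
    split; [exact Hug |]. intros a Hua Hga.
    destruct (le_or_lt Hwo s (q a)) as [H | H]; [exact H |].
    destruct Ha. eauto. }
  destruct (choice (fun g a => sup_set lt u g -> u a /\ lt g a)) as [up Hup].
  { intros g. destruct (classic (sup_set lt u g)) as [[a Ha] | Hg].
    - exists a. auto.
    - exists g. contradiction. }
  destruct (@least_cardinality (cofinal_in lt (sup_set lt u))) as [X [HX HXmin]].
  { exists (sup_set lt u). split; [auto |]. intros g Hg. exists g. unfold le. auto. }
  destruct (@least_cardinality (cofinal_in lt S)) as [Y [HY HYmin]].
  { exists S. split; [auto |]. intros g Hg. exists g. unfold le. auto. }
  apply (Hcf X Y); [split; assumption | split; assumption |].
  apply injects_antisym.
  - apply injects_trans with (Q := fun b => exists s, Y s /\ beta s = b);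
      [apply HXmin | apply injects_image].
    destruct HY as [HYS HYcof]. split.
    + intros b [s [Hs <-]]. destruct (Hu (beta s)) as [a [Ha Hlt]].
      { apply Hbeta; auto. }
      exists a. auto.
    (* If every [beta s] with [s] in [Y] lay below [g], then [q a] would bound [Y], which is cofinal
       in [S], while [S] has no maximum. *)
    + intros g [a [Ha Hga]]. apply NNPP. intros Hg.
      destruct (HS (q a) (Hq a Ha)) as [s' [Hs' Hlt]].
      destruct (HYcof s' Hs') as [s [Hs Hle]].
      assert (Hsq : le lt s (q a)).
      { apply (Hbeta s (HYS s Hs)); [exact Ha |].
        destruct (le_or_lt Hwo g (beta s)) as [H | H].
        - destruct Hg. eauto.
        - exact (wo_trans Hwo _ _ _ H Hga). }
      pose proof (lt_le_trans Hwo Hlt Hle) as H.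
      exact (wo_irrefl Hwo _ (lt_le_trans Hwo H Hsq)).
  - apply injects_trans with (Q := fun b => exists x, X x /\ q (up x) = b);
      [apply HYmin | apply injects_image].
    destruct HX as [HXS HXcof]. split.
    + intros b [x [Hx <-]]. apply Hq, Hup; auto.
    + intros s Hs. destruct (Hbeta s Hs) as [Hb Hlim].
      destruct (Hu _ Hb) as [b [Hub Hlt]].
      destruct (HXcof (beta s)) as [x [Hx Hle]]; [exists b; auto |].
      exists (q (up x)). split; [eauto |].
      destruct (Hup x (HXS x Hx)) as [Hux Hltx].
      apply Hlim; [exact Hux |]. exact (le_lt_trans Hwo Hle Hltx).
Qed.

(** For empty [u] both sup u and |u| are 0, so their cofinalities agree and [u] is excluded. *)
Lemma Ufam_inhabited (u : set L) : Ufam lt u -> exists a, u a.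
Proof.
  intros HU. apply NNPP. intros Hn.
  assert (Hcf : cf_neq lt (sup_set lt u) (fun _ => False)).
  { apply HU. split; [intros x y [] |]. split; [| intros g []].
    apply injects_antisym; apply injects_sub; [intros a [] |].
    intros a Ha. apply Hn. eauto. }
  apply (Hcf (fun _ => False) (fun _ => False)).
  - split; [split; [intros x [] |] |].
    + intros g [a [Ha _]]. destruct Hn. eauto.
    + intros Y _. apply injects_sub. intros a [].
  - split; [split; [intros x [] | intros g []] |].
    intros Y _. apply injects_sub. intros a [].
  - apply injects_antisym; apply injects_sub; auto.
Qed.

(** * The values on a single closed set u *)

Definition closed2 (p : L -> L -> L) (u : set L) : Prop :=
  forall a b, u a -> u b -> u (p a b).

(** [a |-> p x0 a] injects [u] into [u] without the point [b], so |u| is infinite and a last element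
    [t] of [S] could be dropped. *)
Lemma card_no_max (p : L -> L -> L) (u S : set L) (c : L -> L) :
  (forall a b a' b', p a b = p a' b' -> a = a' /\ b = b') ->
  closed2 p u -> no_max u ->
  (forall a, u a -> S (c a)) ->
  (forall a b, u a -> u b -> c a = c b -> a = b) ->
  (forall s, S s -> exists a, u a /\ c a = s) ->
  (forall s, S s -> ~ injects u (fun d => lt d s)) ->
  no_max S.
Proof.
  intros Hp Hcl Hu HcS Hinj Hsurj Hsmall t Ht. apply NNPP. intros Hn.
  assert (Hmax : forall s, S s -> s <> t -> lt s t).
  { intros s Hs Hst. destruct (wo_total Hwo s t) as [H | [H | H]]; [auto | contradiction |].
    destruct Hn. eauto. }
  destruct (Hsurj t Ht) as [x0 [Hx0 _]].
  destruct (Hu x0 Hx0) as [x1 [Hx1 H01]].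
  set (b := p x1 x1).
  assert (Hb : u b) by (apply Hcl; assumption).
  assert (Hmiss : forall a, p x0 a <> b).
  { intros a E. apply Hp in E. destruct E as [E _].
    rewrite E in H01. exact (wo_irrefl Hwo _ H01). }
  apply (Hsmall t Ht).
  (* [a |-> c (p x0 a)] misses [c b]; reroute the value [t] to [c b]. *)
  apply injects_rel with (R := fun a v =>
    (c (p x0 a) <> t /\ v = c (p x0 a)) \/ (c (p x0 a) = t /\ v = c b)).
  - intros a Ha.
    assert (Hpa : u (p x0 a)) by (apply Hcl; assumption).
    destruct (classic (c (p x0 a) = t)) as [E | E].
    + exists (c b). split; [| auto]. apply Hmax; [auto |].
      intros E'. apply (Hmiss a). apply Hinj; [auto | auto | congruence].
    + exists (c (p x0 a)). split; auto.
  - intros a a' v Ha Ha' H H'.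
    assert (Hpa : u (p x0 a)) by (apply Hcl; assumption).
    assert (Hpa' : u (p x0 a')) by (apply Hcl; assumption).
    destruct H as [[N E] | [N E]], H' as [[N' E'] | [N' E']].
    + apply (Hp x0 a x0 a'), Hinj; congruence.
    + destruct (Hmiss a). apply Hinj; congruence.
    + destruct (Hmiss a'). apply Hinj; congruence.
    + apply (Hp x0 a x0 a'), Hinj; congruence.
Qed.

(* For each [i] some initial segment [B] of the enumeration of [u] in type [|u|],
   given by [x i], meets the range of [h i] cofinally often.  The [i < j] with
   [x i = x j] then select distinct points of [B], and fewer than [|u|] colours
   are forbidden for [y j]. *)
Lemma coloring (K : Type) (ltK : K -> K -> Prop) (p : L -> L -> L)
    (h : K -> L -> L) (F : K -> K -> L) (u : set L) :
  well_founded ltK ->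
  (forall a b a' b', p a b = p a' b' -> a = a' /\ b = b') ->
  (forall j i i' a a', ltK i j -> ltK i' j -> lt (F j i) a -> lt (F j i') a' ->
     h i a = h i' a' -> i = i') ->
  Ufam lt u -> no_max u -> closed2 p u ->
  exists x y : K -> L, (forall i, u (x i)) /\ (forall i, u (y i)) /\
    forall i j, ltK i j -> u (F j i) -> (forall a, u a -> u (h i a)) ->
      x i = x j -> y i <> y j.
Proof.
  intros HK Hp Hdisj HU Hu Hcl.
  destruct (Ufam_inhabited HU) as [u0 Hu0].
  destruct (card_enumeration u) as [S [c [Hdown [HcS [Hinj [Hsurj Hsmall]]]]]].
  assert (HcS_inj : injects u S) by (apply injects_map with (f := c); auto).
  assert (HSu : injects S u).
  { apply injects_rel with (R := fun s a => c a = s); [exact Hsurj | congruence]. }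
  assert (Hcf : cf_neq lt (sup_set lt u) S).
  { apply HU. split; [exact Hdown |]. split; [now apply injects_antisym |].
    intros g Hg [f [_ Hf]]. apply (Hsmall g Hg).
    apply injects_rel with (R := fun a d => exists H H', f (exist _ d H) = exist _ a H').
    - intros a Ha. destruct (Hf (exist _ a Ha)) as [[d Hd] E].
      exists d. split; [exact Hd |]. eauto.
    - intros a a' d _ _ [H [H1 E]] [H' [H1' E']].
      rewrite (proof_irrelevance _ H' H), E in E'. now inversion E'. }
  assert (HS : no_max S) by (apply (@card_no_max p u S c); assumption).
  (* The bound in [S] is coded by the point [x i] of [u] that [c] sends to it; [u0] is the default
     when [u] is not closed under [h i]. *)
  destruct (choice (fun i x => u x /\ ((forall a, u a -> u (h i a)) ->
    forall g, u g -> exists a, u a /\ lt g a /\ lt (c (h i a)) (c x)))) as [x Hx].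
  { intros i. destruct (classic (forall a, u a -> u (h i a))) as [Hi | Hi].
    - destruct (@bounded_on_cofinal u S (fun a => c (h i a))) as [s [Hs Hcof]]; auto.
      destruct (Hsurj s Hs) as [x [Hx <-]]. exists x. auto.
    - exists u0. split; [exact Hu0 | contradiction]. }
  pose (R := fun i j => ltK i j /\ u (F j i) /\
    (forall a, u a -> u (h i a)) /\ x i = x j).
  assert (HR : well_founded R).
  { apply wf_incl with (R2 := ltK); [| exact HK]. intros i j H. apply H. }
  destruct (greedy (U := u) (wo_wf Hwo) HR) as [y Hy].
  { intros j H. apply (Hsmall (c (x j))); [apply HcS, Hx |].
    apply (injects_trans H).
    (* As [F j i] is in [u], some [a] in [u] beyond it has [c (h i a)] below [c (x i)], which equals
       [c (x j)]; by [Hdisj] these values differ for different [i]. *)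
    apply injects_rel with (R := fun i d =>
      exists a, u a /\ lt (F j i) a /\ d = c (h i a)).
    - intros i [Hij [HF [Hh E]]].
      destruct (Hx i) as [_ Hi]. destruct (Hi Hh _ HF) as [a [Ha [Hlt Hc]]].
      exists (c (h i a)). rewrite <- E. eauto.
    - intros i i' d [Hij [_ [Hh _]]] [Hij' [_ [Hh' _]]] [a [Ha [Hlt E]]] [a' [Ha' [Hlt' E']]].
      apply (Hdisj j i i' a a'); auto. apply Hinj; [auto | auto | congruence]. }
  exists x, y. split; [apply Hx |]. split; [apply Hy |].
  intros i j Hij HF Hh E. apply Hy. repeat split; assumption.
Qed.
End Cardinal.

(** * Regular cardinals: bounds, pairing, eventually different functions *)

Section Regular.
Variables (L : Type) (lt : L -> L -> Prop).
Hypothesis Hreg : regular_cardinal lt.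
Let Hcard : is_cardinal lt := proj1 Hreg.
Let Hwo : well_order lt := proj1 Hcard.

(** Otherwise a singleton would be cofinal, and the infinite [L] would inject into it. *)
Lemma regular_unbounded (a : L) : exists b, lt a b.
Proof.
  apply NNPP. intros Hn. pose proof Hreg as [_ [[f Hf] Hcof]].
  destruct (Hcof (fun x => x = a)) as [g Hg].
  { split; [intros; exact I |]. intros b _. exists a. split; [reflexivity |].
    destruct (le_or_lt Hwo b a) as [H | H]; [exact H |]. destruct Hn. eauto. }
  assert (E : g (exist _ (f 0) I) = g (exist _ (f 1) I)).
  { apply sig_eq. rewrite (proj2_sig (g (exist _ (f 0) I))).
    now rewrite (proj2_sig (g (exist _ (f 1) I))). }
  apply Hg in E. inversion E as [E']. apply Hf in E'. discriminate.
Qed.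

Lemma regular_bound (A : Type) (S : set A) (b : A -> L) :
  ~ injects (full L) S -> exists g, forall s, S s -> lt (b s) g.
Proof.
  intros HS. apply NNPP. intros Hn. apply HS.
  apply injects_trans with (Q := fun x => exists s, S s /\ b s = x);
    [| apply injects_image].
  apply (proj2 (proj2 Hreg)). split; [intros; exact I |].
  intros g _. apply NNPP. intros Hg. apply Hn. exists g. intros s Hs.
  destruct (le_or_lt Hwo g (b s)) as [H | H]; [| exact H].
  destruct Hg. eauto.
Qed.

(** An injection would split [L] into fibres over the first coordinates below [m]. Each fibre
    injects below [m], so it is bounded; by regularity the bounds are bounded too, and so would be
    [L]. *)
Lemma square_small (m : L) :
  ~ injects (full L) (fun z : L * L => lt (fst z) m /\ lt (snd z) m).
Proof.
  intros H. destruct (injects_fun (m, m) H) as [e [He Hinj]].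
  destruct (choice (fun a b => forall x, fst (e x) = a -> lt x b)) as [b Hb].
  { intros a.
    apply regular_bound with (S := fun x => fst (e x) = a) (b := fun x => x).
    intros Ha. apply (proj2 Hcard m). apply (injects_trans Ha).
    apply injects_map with (f := fun x => snd (e x)).
    - intros x _. now apply (He x I).
    - intros x x' E E' E2. apply Hinj; [exact I | exact I |].
      rewrite (surjective_pairing (e x)), (surjective_pairing (e x')). congruence. }
  destruct (regular_bound b (proj2 Hcard m)) as [g Hg].
  apply (@wo_irrefl _ _ Hwo g). apply wo_trans with (b (fst (e g))); auto.
  apply Hg. now apply (He g I).
Qed.

(* Greedy injection along Gödel's well-order of the square: by maximum, then
   lexicographically. *)
Lemma pairing : exists p : L -> L -> L,
  forall a b a' b', p a b = p a' b' -> a = a' /\ b = b'.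
Proof.
  pose (mx := fun z : L * L =>
    if excluded_middle_informative (lt (fst z) (snd z)) then snd z else fst z).
  assert (Hmx : forall z, le lt (fst z) (mx z) /\ le lt (snd z) (mx z)).
  { intros z. unfold mx. destruct (excluded_middle_informative _) as [H | H].
    - unfold le. auto.
    - split; [right; reflexivity |].
      destruct (le_or_lt Hwo (snd z) (fst z)); tauto. }
  pose (R := fun z z' : L * L => slexprod _ _ lt (slexprod _ _ lt lt) (mx z, z) (mx z', z')).
  assert (HR : well_founded R).
  { apply (wf_inverse_image _ _ _ (fun z => (mx z, z))).
    repeat apply wf_slexprod; apply (wo_wf Hwo). }
  assert (Htot : forall z z', R z z' \/ z = z' \/ R z' z).
  { intros [a b] [a' b']. unfold R.
    destruct (wo_total Hwo (mx (a, b)) (mx (a', b'))) as [H | [H | H]];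
      [left; now apply left_slex | | right; right; now apply left_slex].
    rewrite H.
    destruct (wo_total Hwo a a') as [H1 | [<- | H1]];
      [left; now apply right_slex, left_slex |
      | right; right; now apply right_slex, left_slex].
    destruct (wo_total Hwo b b') as [H1 | [<- | H1]];
      [left; now apply right_slex, right_slex | auto
      | right; right; now apply right_slex, right_slex]. }
  destruct (greedy (U := full L) (wo_wf Hwo) HR) as [p Hp].
  { intros z H. destruct (regular_unbounded (mx z)) as [m Hm].
    apply (@square_small m). apply (injects_trans H). apply injects_sub.
    intros z' Hz'.
    assert (Hle : le lt (mx z') (mx z)).
    { inversion Hz'; [left; assumption | right; reflexivity || congruence]. }
    destruct (Hmx z') as [H1 H2]. pose proof (le_lt_trans Hwo Hle Hm) as H3.
    split; eapply le_lt_trans; eauto. }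
  exists (fun a b => p (a, b)). intros a b a' b' E.
  destruct (Htot (a, b) (a', b')) as [H | [H | H]].
  - now apply Hp in H.
  - now inversion H.
  - apply Hp in H. congruence.
Qed.

(** With [g j] injecting the predecessors of [j] into [L], only those with [g j i] below [a] must be
    avoided at argument [a], which are fewer than lambda. So two different functions differ from
    some point [b] on. *)
Lemma almost_disjoint_family (K : Type) (ltK : K -> K -> Prop) :
  succ_card lt ltK ->
  exists (f : K -> L -> L) (F : K -> K -> L),
    forall j i i' a, ltK i j -> ltK i' j -> lt (F j i) a -> lt (F j i') a ->
      f i a = f i' a -> i = i'.
Proof.
  intros [HK [_ Hinj]].
  assert (l0 : L).
  { pose proof Hreg as [_ [H _]].
    destruct (constructive_indefinite_description _ H) as [n _]. exact (n 0). }
  destruct (choice (fun j (g : K -> L) => forall i i', ltK i j -> ltK i' j ->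
    g i = g i' -> i = i')) as [g Hg].
  { intros j. destruct (injects_fun l0 (Hinj j)) as [g [_ Hg]]. eauto. }
  destruct (choice (fun a (f : K -> L) => forall i j, ltK i j -> lt (g j i) a ->
    f i <> f j)) as [f Hf].
  { intros a. pose (R := fun i j => ltK i j /\ lt (g j i) a).
    assert (HR : well_founded R).
    { apply wf_incl with (R2 := ltK); [| apply (wo_wf HK)]. intros i j H. apply H. }
    destruct (greedy (U := full L) (wo_wf Hwo) HR) as [f Hf].
    - intros j H. apply (proj2 Hcard a). apply (injects_trans H).
      apply injects_map with (f := g j).
      + intros i Hi. apply Hi.
      + intros i i' Hi Hi'. apply Hg; [apply Hi | apply Hi'].
    - exists f. intros i j Hij Ha. apply Hf. split; assumption. }
  destruct (choice (fun (ii : K * K) b => fst ii <> snd ii ->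
    forall a, lt b a -> f a (fst ii) <> f a (snd ii))) as [b Hb].
  { intros [i i']; simpl. destruct (wo_total HK i i') as [H | [H | H]].
    - exists (g i' i). auto.
    - exists l0. contradiction.
    - exists (g i i'). intros _ a Ha E. exact (Hf a i' i H Ha (eq_sym E)). }
  (* [F (j, i)] bounds the points [b (i, i')] for the [i'] that [g j] lists before [i]; of any two
     indices, the one listed later handles the pair. *)
  destruct (choice (fun (ji : K * K) m => forall i', ltK i' (fst ji) ->
    lt (g (fst ji) i') (g (fst ji) (snd ji)) -> lt (b (snd ji, i')) m)) as [F HF].
  { intros [j i]; simpl.
    destruct (@regular_bound K (fun i' => ltK i' j /\ lt (g j i') (g j i))
      (fun i' => b (i, i'))) as [m Hm]; [| eauto].
    intros H. apply (proj2 Hcard (g j i)). apply (injects_trans H).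
    apply injects_map with (f := g j).
    - intros i' Hi'. apply Hi'.
    - intros i1 i2 H1 H2. apply Hg; [apply H1 | apply H2]. }
  exists (fun i a => f a i), (fun j i => F (j, i)).
  assert (Hlt : forall j i i' a, ltK i j -> ltK i' j -> lt (F (j, i)) a ->
    lt (g j i') (g j i) -> f a i <> f a i').
  { intros j i i' a Hi Hi' Ha Hgg.
    apply (Hb (i, i')).
    - simpl. intros <-. exact (wo_irrefl Hwo _ Hgg).
    - apply (wo_trans Hwo _ _ _ (HF (j, i) i' Hi' Hgg) Ha). }
  intros j i i' a Hi Hi' Ha Ha' E.
  destruct (wo_total Hwo (g j i) (g j i')) as [H | [H | H]].
  - destruct (Hlt j i' i a); auto.
  - apply (Hg j); auto.
  - destruct (Hlt j i i' a); auto.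
Qed.
End Regular.

(** * Closure under functions on filter sets, and the final functions *)

(** This is the diagonal intersection of the sets of [u] containing [h a], which fineness puts in
    [D]. *)
Lemma filter_closed {L : Type} (U : set (set L)) (D : set (set (set L))) (h : L -> L) :
  filter_on U D -> fine U D -> normal U D ->
  D (fun u => U u /\ forall a, u a -> u (h a)).
Proof.
  intros [_ [_ [_ [Hup _]]]] Hfine Hnormal.
  apply Hup with (1 := Hnormal _ (fun a => Hfine (h a))); [| tauto].
  intros u [HU H]. split; [exact HU |]. intros a Ha. now apply H.
Qed.

Lemma filter_closed2 {L : Type} (U : set (set L)) (D : set (set (set L)))
    (p : L -> L -> L) :
  filter_on U D -> fine U D -> normal U D -> D (fun u => U u /\ closed2 p u).
Proof.
  intros HD Hfine Hnormal.
  pose proof HD as [_ [_ [_ [Hup _]]]].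
  apply Hup with (1 := Hnormal _ (fun a => filter_closed (p a) HD Hfine Hnormal));
    [| tauto].
  intros u [HU H]. split; [exact HU |]. intros a b Ha. now apply H.
Qed.

Theorem theorem4p1 (L : Type) (ltL : L -> L -> Prop)
  (K : Type) (ltK : K -> K -> Prop) (D : set (set (set L))) :
  regular_cardinal ltL ->
  succ_card ltL ltK ->
  filter_on (Ufam ltL) D -> fine (Ufam ltL) D -> normal (Ufam ltL) D ->
  exists f : K -> set L -> L,
    (forall i u, Ufam ltL u -> u (f i u)) /\
    (forall i j, i <> j -> D (fun u => Ufam ltL u /\ f i u <> f j u)).
Proof.
  intros Hreg Hsucc HD Hfine Hnormal.
  pose proof (proj1 Hreg) as Hcard. pose proof (proj1 Hsucc) as HK.
  destruct (pairing Hreg) as [p Hp].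
  destruct (almost_disjoint_family Hreg Hsucc) as [e [F He]].
  destruct (choice _ (regular_unbounded Hreg)) as [next Hnext].
  (* Coding the argument into the value turns eventual difference into disjoint ranges. *)
  pose (h := fun i a => p a (e i a)).
  (* Closure under [h i] stays a premise for each pair, since there are lambda^+ many [h i] and a
     diagonal intersection handles only lambda many conditions. *)
  destruct (choice (fun (u : set L) (f : K -> L) =>
    (Ufam ltL u -> forall i, u (f i)) /\
    (Ufam ltL u -> (forall a, u a -> u (next a)) -> closed2 p u ->
     forall i j, ltK i j -> u (F j i) -> (forall a, u a -> u (h i a)) ->
       f i <> f j))) as [f Hf].
  { intros u. destruct (classic (Ufam ltL u)) as [HU | HU].
    (* Off the family any value will do; [F i i] is merely an available term of type [L]. *)
    2: { exists (fun i => F i i). split; contradiction. }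
    destruct (classic ((forall a, u a -> u (next a)) /\ closed2 p u)) as [[Hn Hcl] | Hbad].
    - assert (Hmax : no_max ltL u).
      { intros a Ha. exists (next a). auto. }
      destruct (@coloring L ltL Hcard K ltK p h F u) as [x [y [Hx [Hy Hxy]]]]; auto.
      + apply (wo_wf HK).
      + unfold h. intros j i i' a a' Hi Hi' Ha Ha' E.
        apply Hp in E. destruct E as [<- E]. exact (He j i i' a Hi Hi' Ha Ha' E).
      + exists (fun i => p (x i) (y i)). split; [auto |].
        intros _ _ _ i j Hij HF Hh E. apply Hp in E. destruct E as [E1 E2].
        exact (Hxy i j Hij HF Hh E1 E2).
    - destruct (Ufam_inhabited HU) as [a Ha].
      exists (fun _ => a). split; [auto |]. intros _ Hn Hcl. destruct Hbad. auto. }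
  exists (fun i u => f u i). split.
  { intros i u HU. now apply Hf. }
  pose proof HD as [_ [_ [_ [Hup Hmeet]]]].
  assert (Hlt : forall i j, ltK i j -> D (fun u => Ufam ltL u /\ f u i <> f u j)).
  { intros i j Hij.
    apply Hup with (1 := Hmeet _ _
      (Hmeet _ _ (filter_closed next HD Hfine Hnormal) (filter_closed2 p HD Hfine Hnormal))
      (Hmeet _ _ (filter_closed (h i) HD Hfine Hnormal) (Hfine (F j i)))); [| tauto].
    intros u [[[HU Hn] [_ Hcl]] [[_ Hh] [_ HF]]]. split; [exact HU |].
    apply Hf; assumption. }
  intros i j Hij. destruct (wo_total HK i j) as [H | [H | H]].
  - auto.
  - contradiction.
  - apply Hup with (1 := Hlt j i H); [| tauto].
    intros u [HU Hne]. split; [exact HU |]. congruence.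
Qed.
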